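(* Let $G=A\ast B$ be a free product of non-trivial groups $A$ and $B$ and let $H\leq G$ be a subgroup of finite Kurosh rank. Then $[G:H]<\infty$ if and only if $H\cap N\neq\{1\}$ for every normal subgroup $\{1\}\neq N\lhd G$.
   Context: Kurosh rank: By the Kurosh subgroup theorem, a subgroup $H\leq G=A\ast B$ has a free product decomposition $$H=\Big[\ast_{i\in I}\, s_iH_is_i^{-1}\Big]\ast\Big[\ast_{j\in J}\, t_jK_jt_j^{-1}\Big]\ast F(H)$$ where $H_i\leq A$ for $i\in I$, $K_j\leq B$ for $j\in J$, $F(H)$ is a free group intersecting trivially every conjugate of $A$ and of $B$, and the $s_i,t_j\in G$ run over certain sets of double coset representatives of $H\backslash G/A$ and $H\backslash G/B$, respectively. The Kurosh rank of $H$ (relative to the splitting $G=A\ast B$), which may be infinite, is $$\boldsymbol{r}(H)=\operatorname{rank}(F(H))+\#\{i\in I\mid H_i\neq\{1\}\}+\#\{j\in J\mid K_j\neq\{1\}\}.$$ It does not depend on the choices made in the decomposition. *)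

(* Defs.v *)
From HB Require Import structures.
From mathcomp Require Import all_boot.
From mathcomp Require Import boolp classical_sets functions cardinality.

Set Implicit Arguments.
Unset Strict Implicit.
Unset Printing Implicit Defensive.

(* Finite and infinite groups alike: [groupType] is MathComp's structure of
   abstract groups, and subgroups of it are (classical) sets. *)

Local Open Scope classical_set_scope.
Local Open Scope card_scope.
Local Open Scope group_scope.

Section Subgroups.
Variable G : groupType.
Implicit Types (A H N : set G) (g x : G).

Definition subgroup H : Prop := H 1 /\ forall x y, H x -> H y -> H (x / y).

Definition normal_subgroup N : Prop :=
  subgroup N /\ forall g x, N x -> N (g * x * g^-1).

Definition trivial_subgroup : set G := [set 1].

(* g A g^-1; MathComp's [x ^ g] is conjugation on the other side. *)
Definition conj_set g A : set G := [set g * x * g^-1 | x in A].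

Definition left_coset H g : set G := [set g * h | h in H].

Definition finite_index H : Prop := finite_set (range (left_coset H)).

Definition double_coset H A g : set G :=
  [set x | exists h a, [/\ H h, A a & x = h * g * a]].

Definition double_coset_representatives (I : Type) (s : I -> G) H A : Prop :=
  forall x, exists! i, double_coset H A (s i) x.

Definition cyclic_subgroup x : set G :=
  [set y | exists n : nat, y = x ^+ n \/ y = x ^- n].

Definition infinite_order x : Prop := forall n : nat, (0 < n)%N -> x ^+ n <> 1.

End Subgroups.

Arguments trivial_subgroup {G}.

Section FreeProducts.
Variable G : groupType.

(* A letter is an element of G tagged with the factor it is taken from.  A word
   is reduced if its letters are non-trivial elements of their factors and
   consecutive letters come from factors with different indices. *)
Definition reduced_word (I : eqType) (X : I -> set G) (w : seq (I * G)) : Prop :=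
  (forall u, u \in w -> X u.1 u.2 /\ u.2 <> 1) /\
  sorted (fun u v => u.1 != v.1) w.

Definition word_value (I : Type) (w : seq (I * G)) : G := \prod_(u <- w) u.2.

(* K is the (internal) free product of the family X of its subgroups: each
   element of K is represented by exactly one reduced word.  Trivial factors are
   allowed. *)
Definition is_free_product (K : set G) (I : eqType) (X : I -> set G) : Prop :=
  [/\ subgroup K,
      forall i, subgroup (X i) /\ X i `<=` K &
      forall g, K g -> exists! w, reduced_word X w /\ word_value w = g].

Definition is_free_product2 (K A B : set G) : Prop :=
  is_free_product K (fun b : bool => if b then A else B).

(* F is free with basis the family x: it is the free product of the infinite
   cyclic groups generated by the x t. *)
Definition is_free_group_on (F : set G) (T : eqType) (x : T -> G) : Prop :=
  (forall t, infinite_order (x t)) /\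
  is_free_product F (fun t => cyclic_subgroup (x t)).

End FreeProducts.

Section KuroshRank.
Variables (G : groupType) (A B H : set G).

Definition kurosh_factors (I J : Type) (s : I -> G) (HA : I -> set G)
    (t : J -> G) (KB : J -> set G) (F : set G) (k : I + J + unit) : set G :=
  match k with
  | inl (inl i) => conj_set (s i) (HA i)
  | inl (inr j) => conj_set (t j) (KB j)
  | inr _ => F
  end.

(* H = [ * s_i H_i s_i^-1 ] * [ * t_j K_j t_j^-1 ] * F.  As in the Kurosh
   subgroup theorem, the s_i and t_j represent every double coset exactly once,
   and s_i H_i s_i^-1 = H \cap s_i A s_i^-1, t_j K_j t_j^-1 = H \cap t_j B t_j^-1.
   These equalities are needed for the rank to be independent of the choices:
   with only H_i <= A, the group G = <x, y> * <b> = <x> * <b> * <y b> (A free on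
   x, y) would have a decomposition with H_1 = <x>, giving 3 instead of 2. *)
Record kurosh_decomposition := KuroshDecomposition {
  kd_I : choiceType;
  kd_J : choiceType;
  kd_s : kd_I -> G;
  kd_t : kd_J -> G;
  kd_HA : kd_I -> set G;
  kd_KB : kd_J -> set G;
  kd_F : set G;
  kd_T : choiceType;
  kd_basis : kd_T -> G;
  kd_s_repr : double_coset_representatives kd_s H A;
  kd_t_repr : double_coset_representatives kd_t H B;
  kd_HAE : forall i, kd_HA i = A `&` conj_set (kd_s i)^-1 H;
  kd_KBE : forall j, kd_KB j = B `&` conj_set (kd_t j)^-1 H;
  kd_F_free : is_free_group_on kd_F kd_basis;
  kd_F_A : forall g, kd_F `&` conj_set g A = trivial_subgroup;
  kd_F_B : forall g, kd_F `&` conj_set g B = trivial_subgroup;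
  kd_free_product :
    is_free_product H (kurosh_factors kd_s kd_HA kd_t kd_KB kd_F)
}.

(* The Kurosh rank of H is the natural number n. *)
Definition kurosh_rank_is (n : nat) : Prop :=
  exists (D : kurosh_decomposition) (f p q : nat),
    [/\ [set: kd_T D] #= `I_f,
        [set i | kd_HA (k:=D) i <> trivial_subgroup] #= `I_p,
        [set j | kd_KB (k:=D) j <> trivial_subgroup] #= `I_q &
        n = (f + p + q)%N].

Definition finite_kurosh_rank : Prop := exists n, kurosh_rank_is n.

End KuroshRank.

(* Main.v *)
Require Import Defs.
From mathcomp Require Import all_boot.
From mathcomp Require Import boolp classical_sets functions cardinality.

(** If [H] has finite index and [N] is a non-trivial normal subgroup, then [N]
    contains an element [g] whose reduced word begins and ends in different
    factors ([normal_subgroup_spells]). All positive powers of such an element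
    are non-trivial, and one of them lies in [H] ([finite_index_power]).

    Conversely, let [H] have finite Kurosh rank and infinite index. It suffices
    to let [G] act on a set [Y] such that [H] acts faithfully and [G] does not:
    the kernel is then a non-trivial normal subgroup that meets [H] trivially.
    The construction is in the spirit of M. Hall's completion of the core of a
    covering. Finite Kurosh rank makes [H] generated by finitely many elements
    and by its intersections with finitely many conjugates of the factors. Hence
    there is a set [S = H S0], the core, with [S0] finite, in which [1] is joined
    to each point of [S] by right multiplications by elements of the factors that
    never leave [S]. Glue a copy of [G] for [A] and a copy of [G] for [B] along
    [S]. The factor [A] acts on its own copy by right multiplication and fixes
    all other points, and likewise [B]; by the universal property of the free
    product ([free_product_action]) this is an action of [G] on the glued set
    [Y]. Left multiplication by [H] commutes with it. Inside [S] the action is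
    right multiplication, so [h] in [H] sends the point [1] to [h], and [H] acts
    faithfully ([kernel_H]).

    For the element that acts trivially ([acts_trivially_exists]), take [a], [b]
    non-trivial in different factors. A point whose path along the word
    [d = a b a^-1 b^-1] avoids [S] only feels the letters of one factor, whose
    product is [1]. So [d] moves points of finitely many [H]-orbits only, and
    some power [d^n] with [n > 0] lies in the normal subgroup [Z] of the elements
    that preserve each [H]-orbit of [Y]. As [H] has infinite index, some point
    [y0] outside [S] is reached from [S] by one letter, and the other factor,
    say that of [b], fixes [y0]. If [z] is in [Z], then [b z b^-1 z^-1] is in [Z]
    and fixes [y0], because [z] acts on the [H]-orbit of [y0] by an element of
    [H], which commutes with the action. Translating by [G] gives
    such elements for every point in the [G]-orbit of [y0], hence for a point of
    each of the finitely many [H]-orbits moved by [d^n]. Replacing [d^n]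
    successively by its commutators with these elements makes it fix one more
    [H]-orbit at each step ([kill_points]). The commutators can be kept non-trivial by comparing reduced
    words ([commutator_not_central]), unless [G] is infinite dihedral; there
    [b z b^-1 z^-1] is always [z^-2], which therefore already acts trivially
    ([reflection_inverts_zigzag]). *)

Set Implicit Arguments.
Unset Strict Implicit.
Unset Printing Implicit Defensive.

Local Open Scope classical_set_scope.
Local Open Scope group_scope.

(** * Subgroups *)

Lemma finite_set_repeats (T : Type) (A : set T) (f : nat -> T) :
  finite_set A -> (forall n, A (f n)) -> exists i j, (i < j)%N /\ f i = f j.
Proof.
move=> finA Af; apply: contrapT => noij; apply: infinite_nat.
rewrite -(_ : f @^-1` A = [set: nat]); last by apply/seteqP; split=> n _ //; exact: Af.
apply: finite_preimage finA => i j _ _ eij.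
by case: (ltngtP i j) => // lt; case: noij; [exists i, j | exists j, i].
Qed.

Section SubgroupTheory.
Variables (G : groupType) (H : set G).
Hypothesis sgH : subgroup H.

Lemma subgroup1 : H 1. Proof. by case: sgH. Qed.

Lemma subgroupV x : H x -> H x^-1.
Proof. by move=> Hx; case: sgH => H1 /(_ _ _ H1 Hx); rewrite mul1g. Qed.

Lemma subgroupM x y : H x -> H y -> H (x * y).
Proof.
by move=> Hx /subgroupV Hy; case: sgH => _ /(_ _ _ Hx Hy); rewrite invgK.
Qed.

Lemma subgroupX x n : H x -> H (x ^+ n).
Proof.
move=> Hx; elim: n => [|n IHn]; first exact: subgroup1.
by rewrite expgS; apply: subgroupM.
Qed.

Lemma subgroup_nontrivial : H <> trivial_subgroup -> exists2 x, H x & x <> 1.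
Proof.
move=> nH; apply: contrapT => none; apply: nH.
apply/seteqP; split=> [x Hx | _ ->]; last exact: subgroup1.
by apply: contrapT => x1; apply: none; exists x.
Qed.

(** Two of the cosets of the powers of [g] coincide. *)
Lemma finite_index_power g :
  finite_index H -> exists2 n, (0 < n)%N & H (g ^+ n).
Proof.
move=> /finite_set_repeats/(_ (fun n => ex_intro2 _ _ (g ^+ n) Logic.I erefl)).
move=> [i [j [ltij e]]]; exists (j - i)%N; first by rewrite subn_gt0.
have : left_coset H (g ^+ i) (g ^+ j).
  by rewrite e; exists 1; rewrite ?mulg1 //; exact: subgroup1.
case=> h Hh eh; have -> // : g ^+ (j - i) = h.
by apply: (@mulgI _ (g ^+ i)); rewrite eh -expgnDr subnKC // ltnW.
Qed.

End SubgroupTheory.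

(** * Words and actions *)

Section Words.
Variables (G : groupType) (I : eqType) (X : I -> set G).
Implicit Types (w : seq (I * G)) (l : I * G).

Lemma word_value_nil : word_value ([::] : seq (I * G)) = 1.
Proof. by rewrite /word_value big_nil. Qed.

Lemma word_value_cons l w : word_value (l :: w) = l.2 * word_value w.
Proof. by rewrite /word_value big_cons. Qed.

Lemma word_value_cat w1 w2 :
  word_value (w1 ++ w2) = word_value w1 * word_value w2.
Proof. by rewrite /word_value big_cat. Qed.

Lemma reduced_word_nil : reduced_word X [::].
Proof. by split. Qed.

Lemma reduced_word_cons2 l m w :
  reduced_word X (l :: m :: w) <->
  [/\ X l.1 l.2, l.2 <> 1, l.1 != m.1 & reduced_word X (m :: w)].
Proof.
split=> [[lett /= /andP[lm srt]] | [Xl l1 lm [lett srt]]].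
- have [Xl l1] := lett l (mem_head _ _).
  by split=> //; split=> // u wu; apply: lett; rewrite inE wu orbT.
- split=> [u|]; last by rewrite /= lm.
  by rewrite inE => /predU1P[->|/lett].
Qed.

Lemma reduced_word1 l : reduced_word X [:: l] <-> X l.1 l.2 /\ l.2 <> 1.
Proof.
split=> [[lett _] | [Xl l1]]; first by apply: lett; rewrite mem_head.
by split=> // u; rewrite inE => /eqP ->.
Qed.

Lemma reduced_word_behead l w : reduced_word X (l :: w) -> reduced_word X w.
Proof.
move=> [lett srt]; split=> [u wu|]; first by apply: lett; rewrite inE wu orbT.
exact: path_sorted srt.
Qed.

Lemma reduced_word_cat l w m w' :
    reduced_word X (l :: w) -> reduced_word X (m :: w') ->
    (last l w).1 != m.1 ->
  reduced_word X (l :: w ++ m :: w').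
Proof.
move=> [lett srt] [lett' srt'] lm; split=> [u|].
  by rewrite -cat_cons mem_cat => /orP[/lett|/lett'].
by move: srt srt' => /= s1 s2; rewrite cat_path s1 /= lm s2.
Qed.

Variables (Y : Type) (move_by : I -> G -> Y -> Y).

Definition run w y := foldl (fun y l => move_by l.1 l.2 y) y w.

Lemma run_cat w1 w2 y : run (w1 ++ w2) y = run w2 (run w1 y).
Proof. exact: foldl_cat. Qed.

Hypothesis move1 : forall i y, move_by i 1 y = y.
Hypothesis moveM : forall i g h y,
  move_by i (g * h) y = move_by i h (move_by i g y).
Hypothesis sgX : forall i, subgroup (X i).

(** Multiplying a letter into a reduced word gives a reduced word after merging or
    cancelling at most one pair of letters. Carrying [run] along makes the effect
    of a word depend on its value alone, once reduced words are unique. *)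
Lemma reduction w : (forall l, l \in w -> X l.1 l.2) ->
  exists2 w', reduced_word X w' &
    word_value w' = word_value w /\ forall y, run w' y = run w y.
Proof.
elim: w => [|l w IHw] Xw; first by exists [::].
have [|w' rw' [vw' runw']] := IHw; first by move=> u wu; apply: Xw; rewrite inE wu orbT.
have Xl : X l.1 l.2 by apply: Xw; rewrite mem_head.
rewrite word_value_cons -vw' /=.
suff [w2 rw2 [vw2 runw2]] : exists2 w2, reduced_word X w2 &
    word_value w2 = l.2 * word_value w' /\ forall y, run w2 y = run (l :: w') y.
  by exists w2 => //; split=> // y; rewrite runw2 /= -runw'.
case: l Xl {Xw IHw runw' vw'} => i x /= Xx.
case: (pselect (x = 1)) => [->|x1].
  by exists w' => //; split=> [|y]; rewrite /= ?mul1g ?move1.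
case: w' rw' => [|[j z] w'] rw'.
  by exists [:: (i, x)]; rewrite ?reduced_word1 // word_value_cons.
case: (eqVneq i j) => [eij|nij]; last first.
  by exists [:: (i, x), (j, z) & w']; rewrite ?reduced_word_cons2 // word_value_cons.
subst j; rewrite word_value_cons /= mulgA.
have [Xz _] : X i z /\ z <> 1 by case: rw' => /(_ (i, z) (mem_head _ _)).
case: (pselect (x * z = 1)) => [xz|xz].
  exists w'; first exact: reduced_word_behead rw'.
  by split=> [|y]; rewrite ?xz ?mul1g // -moveM xz move1.
exists ((i, x * z) :: w'); last first.
  by split=> [|y /=]; rewrite ?word_value_cons ?moveM.
have Xxz : X i (x * z) by apply: subgroupM.
case: w' rw' => [|m w']; first by rewrite !reduced_word1.
by rewrite !reduced_word_cons2 /= => -[].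
Qed.

End Words.

Section Action.
Variables (G : groupType) (Y : Type).

Definition is_action (act : Y -> G -> Y) :=
  (forall y, act y 1 = y) /\ forall y g h, act y (g * h) = act (act y g) h.

Lemma actX (act : Y -> G -> Y) y g n : is_action act ->
  act y g = y -> act y (g ^+ n) = y.
Proof.
move=> [a1 aM] yg; elim: n => [|n IHn]; first exact: a1.
by rewrite expgS aM yg.
Qed.

Lemma actK (act : Y -> G -> Y) y z g : is_action act ->
  act y g = z -> act z g^-1 = y.
Proof. by move=> [a1 aM] <-; rewrite -aM mulgV. Qed.

Variables (I : eqType) (X : I -> set G) (move_by : I -> G -> Y -> Y).
Hypothesis move1 : forall i y, move_by i 1 y = y.
Hypothesis moveM : forall i g h y,
  move_by i (g * h) y = move_by i h (move_by i g y).

(** The universal property of the free product, for actions: arbitrary actions of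
    the factors on the same set extend to the whole group. *)
Lemma free_product_action : is_free_product [set: G] X ->
  exists2 act : Y -> G -> Y, is_action act &
    forall w y, (forall l, l \in w -> X l.1 l.2) ->
      act y (word_value w) = run move_by w y.
Proof.
move=> [_ sgX normal_form].
have {}sgX i : subgroup (X i) by case: (sgX i).
pose nf g := sval (cid (normal_form g Logic.I)).
have nfP g : reduced_word X (nf g) /\ word_value (nf g) = g.
  by rewrite /nf; case: cid => w [].
have nf_uniq w : reduced_word X w -> nf (word_value w) = w.
  by rewrite /nf => rw; case: cid => w' [_] /(_ w) /= ->.
pose act y g := run move_by (nf g) y.
have actE w y : (forall l, l \in w -> X l.1 l.2) ->
    act y (word_value w) = run move_by w y.
  by move=> /(reduction move1 moveM sgX)[w' rw' [<- <-]]; rewrite /act nf_uniq.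
exists act => //; split=> [y | y g h].
  by rewrite -(word_value_nil G I) actE.
have [rg vg] := nfP g; have [rh vh] := nfP h.
rewrite -{1}vg -{1}vh -word_value_cat actE ?run_cat // => l.
by rewrite mem_cat => /orP[/(proj1 rg)|/(proj1 rh)][].
Qed.

End Action.

(** * Reduced words with prescribed ends *)

Section Spelling.
Variables (G : groupType) (X : bool -> set G).
Hypothesis fpX : is_free_product [set: G] X.
Implicit Types (w v : seq (bool * G)) (i j k l : bool) (g h : G).

Lemma factor_subgroup i : subgroup (X i).
Proof. by case: fpX => _ /(_ i)[]. Qed.

Definition spells i w j g :=
  [/\ reduced_word X w, word_value w = g, ohead (unzip1 w) = Some i
    & ohead (rev (unzip1 w)) = Some j].

Lemma spells_inj i w j g k v l : spells i w j g -> spells k v l g -> w = v.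
Proof.
move=> [rw vw _ _] [rv vv _ _]; case: fpX => _ _ /(_ g Logic.I)[u [_ uniq]].
by rewrite -(uniq w) // -(uniq v).
Qed.

Lemma spells_exists g : g <> 1 -> exists i w j, spells i w j g.
Proof.
move=> g1; case: fpX => _ _ /(_ g Logic.I)[w [[rw vw] _]].
case: w rw vw => [_|[i x] w rw vw]; first by rewrite word_value_nil => /esym.
exists i, ((i, x) :: w), (last (i, x) w).1; split=> //.
by rewrite /unzip1 lastI map_rcons rev_rcons.
Qed.

Lemma spells_neq1 i w j g : spells i w j g -> g <> 1.
Proof.
move=> [rw vw hw _] g1; case: fpX => _ _ /(_ g Logic.I)[u [_ uniq]].
have e : u = [::].
  by apply: uniq; split; rewrite ?word_value_nil //; exact: reduced_word_nil.
by have := uniq w (conj rw vw); rewrite e => e'; rewrite -e' in hw.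
Qed.

Lemma spells_letter i x : X i x -> x <> 1 -> spells i [:: (i, x)] i x.
Proof.
move=> Xx x1; split=> //; last by rewrite word_value_cons word_value_nil mulg1.
by rewrite reduced_word1.
Qed.

Lemma spells_mul i w j g k v l h : spells i w j g -> spells k v l h ->
  j != k -> spells i (w ++ v) l (g * h).
Proof.
move=> [[lw sw] vw hw tw] [[lv sv] vv hv tv] njk.
case: w => [|x w] // in lw sw vw hw tw *; case: v => [|y v] // in lv sv vv hv tv *.
split; rewrite ?word_value_cat ?vw ?vv //; last first.
  rewrite /unzip1 map_cat rev_cat; move: tv.
  by case: (rev (map _ (y :: v))).
apply: reduced_word_cat => //; move: tw hv => /=.
rewrite /unzip1 -map_cons (lastI x w) map_rcons rev_rcons /= => -[->] [->].
exact: njk.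
Qed.

Definition inv_word w := rev [seq (u.1, u.2^-1) | u <- w].

Lemma spells_inv i w j g : spells i w j g -> spells j (inv_word w) i g^-1.
Proof.
move=> [[lw sw] <- hw tw].
have unz : unzip1 (inv_word w) = rev (unzip1 w).
  by rewrite /unzip1 /inv_word map_rev -map_comp.
split; rewrite ?unz ?revK //; last first.
  rewrite /inv_word; elim: w {lw sw hw tw unz} => [|u w IHw].
    by rewrite !word_value_nil invg1.
  rewrite /= rev_cons -cats1 word_value_cat IHw !word_value_cons word_value_nil.
  by rewrite mulg1 invgM.
split=> [u|].
  rewrite mem_rev => /mapP[v /lw[Xv v1] ->]; split => /=.
    exact: (subgroupV (factor_subgroup _) Xv).
  by apply: contra_not v1 => /eqP; rewrite invg_eq1 => /eqP.
rewrite /inv_word rev_sorted sorted_map; apply: sub_sorted sw => u v /=.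
by rewrite eq_sym.
Qed.

Lemma spells_exp i w j g n : spells i w j g -> i != j ->
  exists v, spells i v j (g ^+ n.+1).
Proof.
move=> sg nij; elim: n => [|n [v sv]]; first by exists w; rewrite expg1.
by exists (w ++ v); rewrite expgS; apply: (spells_mul sg sv); rewrite eq_sym.
Qed.

(** If [g] begins and ends in the factor [i], then its conjugate by a letter [x] of
    the other factor begins and ends there, so that [g * (x * g * x^-1)] has its
    ends in different factors. *)
Lemma normal_subgroup_spells N : (forall i, X i <> trivial_subgroup) ->
    normal_subgroup N -> N <> trivial_subgroup ->
  exists g i w j, [/\ N g, spells i w j g & i != j].
Proof.
move=> ntX [sgN normN] /(subgroup_nontrivial sgN)[g Ng /spells_exists].
move=> [i [w [j sg]]]; case: (eqVneq i j) => [eij|]; last by exists g, i, w, j.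
subst j; have [x Xx x1] := subgroup_nontrivial (@factor_subgroup (~~ i)) (@ntX _).
have sx := spells_letter Xx x1.
exists (g * (x * g * x^-1)), i,
  (w ++ ([:: (~~ i, x)] ++ w ++ inv_word [:: (~~ i, x)])), (~~ i).
have nii : i != ~~ i by case: i {sg x Xx x1 sx}.
split=> //; first by apply: subgroupM => //; apply: normN.
rewrite -mulgA; have nii' : ~~ i != i by rewrite eq_sym.
exact: (spells_mul sg (spells_mul sx (spells_mul sg (spells_inv sx) nii) nii') nii).
Qed.

(** A word from [i] to [j] commutes with [u] only if [u] or its inverse is also
    a word from [i] to [j]: otherwise conjugating [u] by [g] or [g^-1] makes it
    longer. In the remaining case one word is a prefix of the other. *)
Lemma commuting_spells i j w g u : i != j -> spells i w j g -> u <> 1 ->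
    u * g = g * u ->
  exists e v, [/\ e = u \/ e = u^-1, spells i v j e & w ++ v = v ++ w].
Proof.
move=> nij sg /spells_exists[k [v [l su]]] ug.
have nji : j != i by rewrite eq_sym.
have size_w : (0 < size w)%N by case: w sg => // -[].
have size_inv : size (inv_word w) = size w by rewrite size_rev size_map.
have same e v' : e = u \/ e = u^-1 -> spells i v' j e ->
  exists e v, [/\ e = u \/ e = u^-1, spells i v j e & w ++ v = v ++ w].
  move=> eu se; exists e, v'; split=> //.
  apply: (spells_inj (spells_mul sg se nji)).
  rewrite (_ : g * e = e * g); first exact: (spells_mul se sg nji).
  case: eu => -> //; apply: (@mulgI _ u).
  by rewrite mulgA ug mulgK mulgA mulgV mul1g.
have longer v1 h k' l' : h * u * h^-1 = u -> spells k' v1 l' (h * u * h^-1) ->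
    size v1 <> (size w + size v + size w)%N.
  move=> -> /spells_inj/(_ su) -> /eqP; apply/negP; rewrite neq_ltn.
  by rewrite addnAC -[X in (X < _)%N]add0n ltn_add2r addn_gt0 size_w.
case: (eqVneq k i) => [ki|nki]; case: (eqVneq l i) => [li|nli]; subst.
- have guV : g * u * g^-1 = u by rewrite -ug mulgK.
  have := longer _ _ _ _ guV (spells_mul (spells_mul sg su nji) (spells_inv sg) nij).
  by rewrite !size_cat size_inv.
- have {}nli : l = j by move: nij nli; case: (l) (i) (j) => [] [] [].
  by subst l; apply: (same u v); [left|].
- have {}nki : k = j by move: nij nki; case: (k) (i) (j) => [] [] [].
  by subst k; apply: (same u^-1); [right|exact: (spells_inv su)].
- have {}nki : k = j by move: nij nki; case: (k) (i) (j) => [] [] [].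
  have {}nli : l = j by move: nij nli; case: (l) (i) (j) => [] [] [].
  subst k l.
  have gVu : g^-1 * u * g^-1^-1 = u by rewrite invgK -mulgA ug mulKg.
  have sgVu := spells_mul (spells_mul (spells_inv sg) su nij) sg nji.
  rewrite -{2}(invgK g) in sgVu.
  by have := longer _ _ _ _ gVu sgVu; rewrite !size_cat size_inv.
Qed.

(** So no non-trivial [u] commutes with two words from [i] to [j] that differ in
    their first two letters. *)
Lemma commuting_spells_prefix i j w g u x y : i != j ->
    spells i [:: x, y & w] j g -> u <> 1 -> u * g = g * u ->
  exists e v, (e = u \/ e = u^-1) /\ spells i [:: x, y & v] j e.
Proof.
move=> nij sg u1 /(commuting_spells nij sg u1)[e [v [eu se wv]]].
suff [v' sv'] : exists v', spells i [:: x, y & v'] j e by exists e, v'.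
case: v se wv => [|x' [|y' v]] se.
- by case: se.
- by case: se => _ _ [xi] [xj]; move: nij; rewrite -xi -xj eqxx.
- by move=> -[-> -> _]; exists v.
Qed.

Section Zigzag.
Variables (i j : bool).
Hypothesis nij : i != j.

Let nji : j != i. Proof. by rewrite eq_sym. Qed.

(** The commutator, written so that its reduced word begins with [a]. *)
Definition zigzag a b : G := a * b * a^-1 * b^-1.

Lemma zigzag_neq1 a b n : X i a -> a <> 1 -> X j b -> b <> 1 ->
  zigzag a b ^+ n.+1 <> 1.
Proof.
move=> Xa a1 Xb b1.
have sa := spells_letter Xa a1; have sb := spells_letter Xb b1.
have sab := spells_mul (spells_mul (spells_mul sa sb nij) (spells_inv sa) nji)
  (spells_inv sb) nij.
by have [v /spells_neq1] := spells_exp n sab nij.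
Qed.

(** The last letter [b^-1] of a power of [zigzag a b] is left out: it is the one
    that merges with other letters in [commutator_zigzag_spells]. *)
Lemma zigzag_spells a b n : X i a -> a <> 1 -> X j b -> b <> 1 ->
  exists w, spells i ((i, a) :: w) i (zigzag a b ^+ n * (a * b * a^-1)).
Proof.
move=> Xa a1 Xb b1.
have sa := spells_letter Xa a1; have sb := spells_letter Xb b1.
have saba := spells_mul (spells_mul sa sb nij) (spells_inv sa) nji.
elim: n => [|n [w sw]]; first by eexists; rewrite mul1g; exact: saba.
have sabab := spells_mul saba (spells_inv sb) nij.
by eexists; rewrite expgS -mulgA; exact: (spells_mul sabab sw nji).
Qed.

(** With [zigzag a b ^+ n.+1 = y * b^-1], the commutator is
    [b * y * b^-1 * y^-1], and this product is reduced as written. *)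
Lemma commutator_zigzag_spells a b n :
    X i a -> a <> 1 -> X j b -> b <> 1 ->
  exists w, spells j [:: (j, b), (i, a) & w] i
    (b * zigzag a b ^+ n.+1 * b^-1 * zigzag a b ^- n.+1).
Proof.
move=> Xa a1 Xb b1; have sb := spells_letter Xb b1.
have [w sw] := zigzag_spells n Xa a1 Xb b1.
rewrite (_ : zigzag a b ^+ n.+1 = zigzag a b ^+ n * (a * b * a^-1) * b^-1); last first.
  by rewrite expgSr -mulgA.
eexists; set y := (_ * (a * b * a^-1)) in sw *.
have -> : b * (y * b^-1) * b^-1 * (y * b^-1)^-1 = b * y * b^-1 * y^-1.
  by rewrite invgM invgK !mulgA mulgVK.
exact: (spells_mul (spells_mul (spells_mul sb sw nji) (spells_inv sb) nij)
  (spells_inv sw) nji).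
Qed.

(** The words of the commutators of [b] and [b'] with powers of [zigzag a b] and
    [zigzag a' b'] begin with [b a] and [b' a'], so nothing non-trivial commutes
    with both. *)
Lemma commutator_not_central (N : set G) :
    (forall a b, X i a -> a <> 1 -> X j b -> b <> 1 ->
       exists n, N (zigzag a b ^+ n.+1)) ->
  forall a b a' b', X i a -> a <> 1 -> X j b -> b <> 1 ->
    X i a' -> a' <> 1 -> X j b' -> b' <> 1 -> (a, b) <> (a', b') ->
  forall u, u <> 1 -> exists x z,
    [/\ X j x, N z & u * (x * z * x^-1 * z^-1) <> x * z * x^-1 * z^-1 * u].
Proof.
move=> zzN a b a' b' Xa a1 Xb b1 Xa' a1' Xb' b1' ab u u1.
have [n Nz] := zzN _ _ Xa a1 Xb b1; have [n' Nz'] := zzN _ _ Xa' a1' Xb' b1'.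
apply: contrapT => central.
have {}central x z : X j x -> N z ->
    u * (x * z * x^-1 * z^-1) = x * z * x^-1 * z^-1 * u.
  by move=> Xx Nz0; apply: contrapT => ne; apply: central; exists x, z.
have [w sw] := commutator_zigzag_spells n Xa a1 Xb b1.
have [w' sw'] := commutator_zigzag_spells n' Xa' a1' Xb' b1'.
have [e [v [eu se]]] :=
  commuting_spells_prefix nji sw u1 (central _ _ Xb Nz).
have [e' [v' [eu' se']]] :=
  commuting_spells_prefix nji sw' u1 (central _ _ Xb' Nz').
have [ee|ee] : e' = e \/ e' = e^-1.
  by case: eu eu' => -> [] ->; rewrite ?invgK; auto.
- rewrite ee in se'; have ew := spells_inj se se'.
  have eb := congr1 (fun w => (head (j, b) w).2) ew.
  have ea := congr1 (fun w => (head (j, b) (behead w)).2) ew.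
  by move: ea eb => /= ea eb; rewrite ea eb in ab.
- rewrite ee in se'; have := spells_inv se; have := se'.
  move=> s1 s2; have es := spells_inj s1 s2; rewrite -es in s2.
  by case: s2 => _ _ [ji] _; move: nij; rewrite ji eqxx.
Qed.

(** In the infinite dihedral group the translations commute, but every reflection
    inverts them. *)
Lemma reflection_inverts_zigzag a b :
    (forall x, X i x -> x <> 1 -> x = a) -> (forall x, X j x -> x <> 1 -> x = b) ->
    X i a -> a <> 1 -> X j b -> b <> 1 ->
  forall g n, let x := g^-1 * b * g in
    x * zigzag a b ^+ n * x^-1 = zigzag a b ^- n.
Proof.
move=> ua ub Xa a1 Xb b1 g n /=.
have invE k c : X k c -> c <> 1 -> (forall x, X k x -> x <> 1 -> x = c) -> c^-1 = c.
  move=> Xc c1; apply; first exact: (subgroupV (factor_subgroup k) Xc).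
  by apply: contra_not c1 => /eqP; rewrite invg_eq1 => /eqP.
have aV : a^-1 = a by apply: (invE i).
have bV : b^-1 = b by apply: (invE j).
have aa : a * a = 1 by rewrite -{2}aV mulgV.
have bb : b * b = 1 by rewrite -{2}bV mulgV.
set d := zigzag a b.
have dE : d = a * b * a * b by rewrite /d /zigzag aV bV.
have dV : d^-1 = b * a * b * a by rewrite dE !invgM aV bV !mulgA.
have bd : b * d * b^-1 = d^-1 by rewrite dV dE bV -!mulgA bb mulg1.
have ad : a * d * a^-1 = d^-1.
  by rewrite dV dE aV !mulgA aa mul1g.
clearbody d.
have conjV x : x * d^-1 * x^-1 = (x * d * x^-1)^-1 by rewrite !invgM invgK !mulgA.
have gd : g * d * g^-1 = d \/ g * d * g^-1 = d^-1.
  case: fpX => _ _ /(_ g Logic.I)[w [[[lw _] <-] _]].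
  elim: w lw => [|[k x] w IHw] lw.
    by rewrite word_value_nil mul1g invg1 mulg1; left.
  rewrite word_value_cons /=.
  have -> : x * word_value w * d * (x * word_value w)^-1
      = x * (word_value w * d * (word_value w)^-1) * x^-1.
    by rewrite invgM !mulgA.
  have [Xx x1] := lw (k, x) (mem_head _ _).
  have xd : x * d * x^-1 = d^-1.
    move: Xx x1 => /=; case: (eqVneq k i) => [-> Xx /(ua _ Xx) -> //|nki].
    have -> : k = j by move: nij nki; case: (k) (i) (j) => [] [] [].
    by move=> Xx /(ub _ Xx) ->.
  have [|->|->] := IHw; first by move=> u wu; apply: lw; rewrite inE wu orbT.
    by right.
  by left; rewrite conjV xd invgK.
have xd : (g^-1 * b * g) * d * (g^-1 * b * g)^-1 = d^-1.
  have -> : (g^-1 * b * g) * d * (g^-1 * b * g)^-1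
      = g^-1 * (b * (g * d * g^-1) * b^-1) * g.
    by rewrite !invgM invgK !mulgA.
  have gdV e : g * d * g^-1 = e -> g^-1 * e * g = d.
    by move=> <-; rewrite !mulgA mulVg mul1g mulgVK.
  have gV e : g^-1 * e^-1 * g = (g^-1 * e * g)^-1.
    by rewrite !invgM invgK !mulgA.
  case: (gd) => gde; rewrite gde ?conjV bd ?invgK; first by rewrite gV gdV.
  by rewrite -[X in _ * X * _](invgK d) gV gdV.
set x := g^-1 * b * g in xd *.
have conjE y : x * y * x^-1 = y ^ x^-1 by rewrite conjgE invgK mulgA.
by rewrite conjE conjXg -conjE xd expVgn.
Qed.

End Zigzag.
End Spelling.

(** * Two copies of the group glued along a core *)

(** [H] is generated by its elements in [L] and by its intersections with the
    conjugates of the factors by elements of [L]. The induction form is the one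
    that [act_base_H] needs. *)
Definition generated_by (G : groupType) (X : bool -> set G) (H : set G)
    (L : seq G) : Prop :=
  forall P : set G, subgroup P -> (forall s, s \in L -> H s -> P s) ->
    (forall s i x,
      s \in L -> X i x -> H (s * x * s^-1) -> P (s * x * s^-1)) ->
  H `<=` P.

(** Each element of [S0] is joined to [1] inside [S0]. *)
Definition prefix_closed (G : groupType) (X : bool -> set G) (S0 : seq G) : Prop :=
  forall s, s \in S0 -> exists w : seq (bool * G),
    [/\ forall l, l \in w -> X l.1 l.2, word_value w = s &
      forall w1 w2, w = w1 ++ w2 -> word_value w1 \in S0].

Section Core.
Variables (G : groupType) (X : bool -> set G) (H : set G) (S0 : seq G).
Hypothesis fpX : is_free_product [set: G] X.
Hypothesis sgH : subgroup H.

Definition core : set G := [set g | exists2 h, H h & exists2 s, s \in S0 & g = h * s].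

Lemma coreM h g : H h -> core (h * g) <-> core g.
Proof.
move=> Hh; split=> [[k Hk [s Ss e]] | [k Hk [s Ss ->]]]; last first.
  by exists (h * k); [exact: subgroupM | exists s; rewrite ?mulgA].
exists (h^-1 * k); first by apply: subgroupM => //; exact: subgroupV.
by exists s; rewrite // -mulgA -e mulKg.
Qed.

(** [point i g] is the point [g] of the copy of the group that belongs to the
    factor [i]; the mark [None] identifies the two copies along the core. The
    pairs that are not of this form are fixed by everything. *)
Definition point (i : bool) (g : G) : G * option bool :=
  (g, if `[< core g >] then None else Some i).

Definition slide (i : bool) (x : G) (y : G * option bool) :=
  if y == point i y.1 then point i (y.1 * x) else y.

Definition shift (h : G) (y : G * option bool) := (h * y.1, y.2).

Lemma slide_point i x g : slide i x (point i g) = point i (g * x).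
Proof. by rewrite /slide eqxx. Qed.

Lemma slide1 i y : slide i 1 y = y.
Proof. by rewrite /slide mulg1; case: eqP. Qed.

Lemma slideM i g h y : slide i (g * h) y = slide i h (slide i g y).
Proof.
rewrite {1 3}/slide; case: ifP => yi; first by rewrite slide_point mulgA.
by rewrite /slide yi.
Qed.

Lemma point_core i j g : core g -> point i g = point j g.
Proof. by move=> cg; rewrite /point asboolT. Qed.

Lemma slide_outside i j x g : i != j -> ~ core g -> slide i x (point j g) = point j g.
Proof.
move=> nij cg; rewrite /slide /point /= asboolF //.
by rewrite xpair_eqE eqxx /= (inj_eq Some_inj) eq_sym (negbTE nij).
Qed.

Lemma shift_point h i g : H h -> shift h (point i g) = point i (h * g).
Proof. by move=> Hh; rewrite /shift /point /= (asbool_equiv_eq (coreM g Hh)). Qed.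

Lemma shiftM h k y : shift (h * k) y = shift h (shift k y).
Proof. by rewrite /shift mulgA. Qed.

Lemma shift1 y : shift 1 y = y.
Proof. by case: y => g o; rewrite /shift mul1g. Qed.

Lemma shiftK h : cancel (shift h) (shift h^-1).
Proof. by move=> y; rewrite -shiftM mulVg shift1. Qed.

Lemma slide_shift h i x y : H h -> slide i x (shift h y) = shift h (slide i x y).
Proof.
move=> Hh; rewrite /slide /= -(shift_point i y.1 Hh) (can_eq (shiftK h)).
by case: ifP => // _; rewrite shift_point // mulgA.
Qed.

Definition base g := point true g.

Variable act : G * option bool -> G -> G * option bool.
Hypothesis actP : is_action act.
Hypothesis act_run : forall (w : seq (bool * G)) y, (forall l, l \in w -> X l.1 l.2) ->
  act y (word_value w) = run slide w y.

Lemma act1 y : act y 1 = y. Proof. by case: actP. Qed.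
Lemma actM y g h : act y (g * h) = act (act y g) h. Proof. by case: actP. Qed.

Lemma act_inj g : injective (act^~ g).
Proof. by apply: (can_inj (g := act^~ g^-1)) => y; apply: actK. Qed.

Lemma act_factor i x y : X i x -> act y x = slide i x y.
Proof.
move=> Xx; have := @act_run [:: (i, x)] y.
rewrite word_value_cons word_value_nil mulg1 => -> // l.
by rewrite inE => /eqP ->.
Qed.

Lemma word_exists g :
  exists2 w, (forall l, l \in w -> X l.1 l.2) & word_value w = g.
Proof.
case: fpX => _ _ /(_ g Logic.I)[w [[[lw _] vw] _]].
by exists w => // l /lw[].
Qed.

Lemma act_shift h y g : H h -> act (shift h y) g = shift h (act y g).
Proof.
move=> Hh; have [w lw <-] := word_exists g; rewrite !act_run //.
by elim: w {lw} y => //= l w IHw y; rewrite slide_shift.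
Qed.

(** ** Paths inside the core *)

Hypothesis S0_connected : prefix_closed X S0.
Hypothesis H_generated : generated_by X H S0.

Lemma core_S0 s : s \in S0 -> core s.
Proof. by move=> Ss; exists 1; [exact: subgroup1|exists s; rewrite ?mul1g]. Qed.

Lemma act_base_factor s i x : core s -> X i x ->
  act (base s) x = point i (s * x).
Proof.
by move=> cs Xx; rewrite (act_factor _ Xx) /base (point_core _ i cs) slide_point.
Qed.

Lemma act_base_S0 s : s \in S0 -> act (base 1) s = base s.
Proof.
move=> /S0_connected[w [lw <- prefix]].
elim/last_ind: w lw prefix => [|w l IHw] lw prefix; first by rewrite word_value_nil act1.
rewrite -cats1 word_value_cat word_value_cons word_value_nil mulg1 actM.
have cw1 w1 w2 : rcons w l = w1 ++ w2 -> core (word_value w1).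
  by move=> /prefix /core_S0.
rewrite IHw => [|m mw|w1 w2 e].
- rewrite (@act_base_factor _ l.1); last 2 first.
  + by apply: (cw1 w [:: l]); rewrite cats1.
  + by apply: lw; rewrite mem_rcons mem_head.
  apply: point_core.
  have := cw1 (rcons w l) [::]; rewrite cats0 => /(_ erefl).
  by rewrite -cats1 word_value_cat word_value_cons word_value_nil mulg1.
- by apply: lw; rewrite mem_rcons inE mw orbT.
- by apply: (prefix w1 (rcons w2 l)); rewrite -rcons_cat e.
Qed.

(** The elements of [H] for which this holds form a subgroup, since [shift]
    commutes with the action. For a generator [s * x * s^-1] the path from [1]
    through [s] and [s * x] stays in the core, because [s * x] is the translate of
    [s] by the generator itself. *)
Lemma act_base_H h : H h -> act (base 1) h = base h.
Proof.
have shift_base k g : H k -> shift k (base g) = base (k * g) by exact: shift_point.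
pose P := [set h | H h /\ act (base 1) h = base h].
suff HP : H `<=` P by move=> /HP[].
have sgP : subgroup P.
  split=> [|x y [Hx ax] [Hy ay]]; first by split; [exact: subgroup1|exact: act1].
  split; first by case: sgH => _; apply.
  have ayV : act (base 1) y^-1 = base y^-1.
    apply: (can_inj (shiftK y)); rewrite -act_shift // !shift_base // mulg1 mulgV.
    exact: actK.
  have -> : act (base 1) (x / y) = act (shift x (base 1)) y^-1.
    by rewrite actM ax shift_base ?mulg1.
  by rewrite act_shift // ayV shift_base.
apply: H_generated => // [s Ss Hs|s i x Ss Xx Hx].
  by split=> //; exact: act_base_S0.
split=> //; rewrite actM actM act_base_S0 // (act_base_factor (core_S0 Ss) Xx).
have e : s * x = s * x * s^-1 * s by rewrite mulgVK.
have -> : point i (s * x) = shift (s * x * s^-1) (base s).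
  rewrite shift_base // /base -e; apply: point_core.
  by rewrite e; apply/(coreM s Hx)/core_S0.
rewrite act_shift // (@actK _ _ _ (base 1)) ?shift_base ?mulg1 //.
exact: act_base_S0.
Qed.

Lemma act_base_core s : core s -> act (base 1) s = base s.
Proof.
move=> [h Hh [s0 Ss0 ->]]; rewrite actM act_base_H // /base -{1}[h]mulg1.
by rewrite -!(shift_point true _ Hh) act_shift // -/(base 1) act_base_S0.
Qed.

Lemma kernel_H g : H g -> (forall y, act y g = y) -> g = 1.
Proof. by move=> Hg /(_ (base 1)); rewrite act_base_H // => -[]. Qed.

(** ** Elements that preserve every orbit of the subgroup *)

Definition orbit_preserving : set G :=
  [set z | forall y, exists2 h, H h & act y z = shift h y].

Lemma orbit_preserving_normal : normal_subgroup orbit_preserving.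
Proof.
split=> [|g z Zz y]; last first.
  have [h Hh e] := Zz (act y g); exists h => //.
  by rewrite 2!actM e act_shift // (@actK _ _ _ y).
split=> [y|z1 z2 Z1 Z2 y].
  by exists 1; rewrite ?act1 ?shift1 //; exact: subgroup1.
have [h Hh e] := Z1 y; have [k Hk ek] := Z2 (act y z2^-1).
exists (h * k^-1); first by case: sgH => _; apply.
rewrite actM e act_shift // shiftM; congr shift.
by apply: (can_inj (shiftK k)); rewrite -ek -actM mulVg act1 -shiftM mulgV shift1.
Qed.

(** On the orbit of [y] under [shift], [z] acts as an element of [H], and this
    commutes with [c], which fixes that orbit pointwise. *)
Lemma commutator_fixes y z c h : H h -> act y c = y -> act y z = shift h y ->
  act y (c * z * c^-1 * z^-1) = y.
Proof.
move=> Hh yc yz; have ycV : act y c^-1 = y by apply: actK.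
rewrite !actM yc yz (act_shift _ _ Hh) ycV.
by apply: actK.
Qed.

(** ** Zigzags move finitely many orbits of the subgroup *)

(** Off the core a point of the copy [i] does not belong to the other copy, so the
    letters of the other factor fix it. *)
Lemma run_outside i w g :
    (forall w1 w2 s, w = w1 ++ w2 -> core s -> run slide w1 (point i g) <> base s) ->
  run slide w (point i g) = point i (g * \prod_(l <- w | l.1 == i) l.2).
Proof.
elim: w g => [|l w IHw] g avoid; first by rewrite big_nil mulg1.
have ng : ~ core g.
  by move=> cg; apply: (avoid [::] (l :: w) g) => //=; exact: point_core.
have step : slide l.1 l.2 (point i g)
    = point i (g * if l.1 == i then l.2 else 1).
  case: (eqVneq l.1 i) => [->|nli]; first by rewrite slide_point.
  by rewrite mulg1 slide_outside.
rewrite big_cons /= step IHw; first by case: ifP; rewrite -mulgA ?mul1g.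
move=> w1 w2 s e cs; rewrite -step => /(avoid (l :: w1) w2 s); apply => //.
by rewrite e.
Qed.

(** Otherwise the point stays in one copy, where only the letters of one factor
    act, and their product is [1]. *)
Lemma moved_meets_core w y : (forall l, l \in w -> X l.1 l.2) ->
    (forall i, \prod_(l <- w | l.1 == i) l.2 = 1) ->
    act y (word_value w) <> y ->
  exists w1 w2 s, [/\ w = w1 ++ w2, core s & act y (word_value w1) = base s].
Proof.
move=> lw w1 moved; apply: contrapT => avoid; apply: moved; rewrite act_run //.
have [[i yi]|nyi] := pselect (exists i, y = point i y.1).
  rewrite yi run_outside ?w1 ?mulg1 // => v v' s e cs; rewrite -yi => ys.
  apply: avoid; exists v, v', s; split=> //; rewrite act_run // => l lv.
  by apply: lw; rewrite e mem_cat lv.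
elim: w {lw w1 avoid} => //= l w IHw; rewrite {2}/slide.
by case: eqP => [e|]; [case: nyi; exists l.1|].
Qed.

Definition supported (F : seq G) u := forall y, act y u <> y ->
  exists2 h, H h & exists2 g, g \in F & y = shift h (act (base 1) g).

(** The core consists of finitely many orbits of [H], and a moved point is the
    translate of a core point by the inverse of one of the prefixes of the word. *)
Lemma zigzag_supported i j a b : i != j -> X i a -> X j b ->
  exists F, supported F (zigzag a b).
Proof.
move=> nij Xa Xb.
pose w := [:: (i, a); (j, b); (i, a^-1); (j, b^-1)].
have lw l : l \in w -> X l.1 l.2.
  rewrite !inE => /or4P[] /eqP -> //=; apply: subgroupV => //;
    exact: (factor_subgroup fpX).
have vw : word_value w = zigzag a b.
  by rewrite !word_value_cons word_value_nil mulg1 /= !mulgA.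
have balanced k : \prod_(l <- w | l.1 == k) l.2 = 1.
  rewrite !big_cons big_nil /=; case: (eqVneq i k) => [ik|_].
    by rewrite -ik eq_sym (negbTE nij) mulg1 mulgV.
  by case: (j == k); rewrite ?mulg1 ?mulgV.
exists [seq s * (word_value (take n w))^-1 | s <- S0, n <- iota 0 (size w).+1].
move=> y; rewrite -vw => /(moved_meets_core lw balanced)[w1 [w2 [s [ew cs e]]]].
have [h Hh [s0 Ss0 es]] := cs; exists h => //.
exists (s0 * (word_value w1)^-1).
  apply/allpairsP; exists (s0, size w1); rewrite /fst /snd.
  split=> //; last by rewrite ew take_size_cat.
  by rewrite mem_iota add0n leq0n ltnS ew size_cat leq_addr.
rewrite actM act_base_S0 // -act_shift // shift_point // -es.
by apply/esym/actK.
Qed.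

(** [u] permutes the orbits of [H] and moves finitely many of them, so each orbit
    returns to itself after some number of steps; multiply these numbers. *)
Lemma supported_power_orbit_preserving F u : supported F u ->
  exists n, orbit_preserving (u ^+ n.+1).
Proof.
move=> suppF; pose f g := act (base 1) g.
have return_time g : exists n, exists2 h, H h & act (f g) (u ^+ n.+1) = shift h (f g).
  have [[k fk]|moving] := pselect (exists k, act (f g) (u ^+ k.+1) = act (f g) (u ^+ k)).
    exists 0%N, 1; rewrite ?shift1 ?expg1; first exact: subgroup1.
    by apply: (@act_inj (u ^+ k)); rewrite /= -[LHS]actM -expgS.
  have rep k : exists g',
      g' \in F /\ exists2 h, H h & act (f g) (u ^+ k) = shift h (f g').
    have [|h Hh [g' Fg' e]] := suppF (act (f g) (u ^+ k)); last first.
      by exists g'; split=> //; exists h.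
    by move=> e; apply: moving; exists k; rewrite expgSr actM.
  have [r rP] := choice rep.
  have [i [j [ltij eij]]] := finite_set_repeats (finite_seq F) (fun k => proj1 (rP k)).
  have [h Hh eh] := proj2 (rP i); have [k Hk ek] := proj2 (rP j).
  exists (j - i).-1, (k * h^-1); first by case: sgH => _; apply.
  rewrite prednK ?subn_gt0 //.
  apply: (@act_inj (u ^+ i)); rewrite /= -[LHS]actM -expgnDr subnK; last exact: ltnW.
  by rewrite ek -eij act_shift ?eh; [rewrite -shiftM mulgVK|case: sgH => _; apply].
have [t tP] := choice return_time.
pose n := (\prod_(g <- F) (t g).+1)%N.
have n0 : (0 < n)%N by rewrite prodn_gt0.
exists n.-1; rewrite prednK // => y.
have [yu|] := pselect (act y u = y).
  by exists 1; rewrite ?shift1; [exact: subgroup1|exact: actX].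
move=> /suppF[h Hh [g Fg ->]].
have [k Hk ek] := tP g.
have -> : n = ((t g).+1 * (n %/ (t g).+1))%N.
  by rewrite mulnC divnK // /n (big_rem g) //= dvdn_mulr.
rewrite act_shift //.
have [m Hm em] : exists2 m, H m &
    act (f g) (u ^+ ((t g).+1 * (n %/ (t g).+1))) = shift m (f g).
  elim: (n %/ _)%N => [|q [m Hm em]].
    by exists 1; rewrite ?muln0 ?act1 ?shift1 //; exact: subgroup1.
  exists (k * m); first exact: subgroupM.
  by rewrite mulnS expgnDr actM ek act_shift // em shiftM.
exists (h * m * h^-1); first by case: sgH => _; apply=> //; exact: subgroupM.
by rewrite -/(f g) em -!shiftM mulgVK.
Qed.

(** ** An element that acts trivially *)

(** The commutator of two orbit-preserving elements fixes every point that one of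
    them fixes. So replacing [u] by its commutator with an element that fixes the
    next point of [F] keeps all the points fixed so far. *)
Lemma kill_points (F : seq G) :
    (forall g u, u <> 1 -> exists v, [/\ orbit_preserving v,
       act (act (base 1) g) v = act (base 1) g & u * v <> v * u]) ->
  forall u, u <> 1 -> orbit_preserving u ->
  exists u', [/\ u' <> 1, orbit_preserving u', forall y, act y u = y -> act y u' = y &
    forall g, g \in F -> act (act (base 1) g) u' = act (base 1) g].
Proof.
move=> killer u u1 Zu; elim: F => [|g F [u' [u'1 Zu' fixu fixF]]]; first by exists u.
have [v [Zv vg uv]] := killer g u' u'1.
have sgZ := proj1 orbit_preserving_normal.
have fix_u' y : act y u' = y -> act y (u' * v * u'^-1 * v^-1) = y.
  by move=> yu'; have [h Hh /(commutator_fixes Hh yu')] := Zv y.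
exists (u' * v * u'^-1 * v^-1); split=> [e||y /fixu|k].
- by apply: uv; rewrite -{2}(divg1_eq e) mulgVK.
- have Zuv := subgroupM sgZ (subgroupM sgZ Zu' Zv) (subgroupV sgZ Zu').
  exact: (subgroupM sgZ Zuv (subgroupV sgZ Zv)).
- exact: fix_u'.
- rewrite inE => /predU1P[->|/fixF]; last exact: fix_u'.
  have [h Hh /(commutator_fixes Hh vg) fixv] := Zu' (act (base 1) g).
  have -> : u' * v * u'^-1 * v^-1 = (v * u' * v^-1 * u'^-1)^-1.
    by rewrite !invgM !invgK !mulgA.
  exact: actK.
Qed.

(** The point [s * x] lies in the copy of the factor [i] and outside the core,
    hence the other factor fixes it. *)
Lemma acts_trivially_exists s i x : (forall k, X k <> trivial_subgroup) ->
    core s -> X i x -> ~ core (s * x) ->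
  exists2 u, u <> 1 & forall y, act y u = y.
Proof.
move=> ntX cs Xx nsx; pose j := ~~ i.
have nij : i != j by rewrite /j; case: (i).
have nji : j != i by rewrite eq_sym.
have sgX k : subgroup (X k) by exact: (factor_subgroup fpX).
pose y0 := act (base 1) (s * x).
have y0E : y0 = point i (s * x).
  by rewrite /y0 actM act_base_core // (act_base_factor cs Xx).
have y0b b : X j b -> act y0 b = y0.
  by move=> Xb; rewrite (act_factor _ Xb) y0E slide_outside.
have orbit g : act (base 1) g = act y0 ((s * x)^-1 * g).
  by rewrite /y0 -actM mulVKg.
have zz a b : X i a -> X j b -> exists n, orbit_preserving (zigzag a b ^+ n.+1).
  move=> Xa Xb; have [F suppF] := zigzag_supported nij Xa Xb.
  exact: supported_power_orbit_preserving suppF.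
have [a Xa a1] := subgroup_nontrivial (sgX i) (@ntX i).
have [b Xb b1] := subgroup_nontrivial (sgX j) (@ntX j).
have [F suppF] := zigzag_supported nij Xa Xb.
have [n Zz] := zz a b Xa Xb.
suff [u [u1 fixu fixF]] : exists u, [/\ u <> 1,
    forall y, act y (zigzag a b) = y -> act y u = y &
    forall g, g \in F -> act (act (base 1) g) u = act (base 1) g].
  exists u => // y; have [/fixu //|] := pselect (act y (zigzag a b) = y).
  by move=> /suppF[h Hh [g Fg ->]]; rewrite act_shift // fixF.
have [[a' [b' [Xa' a1' Xb' b1' ab]]]|same_pair] := pselect (exists a' b',
    [/\ X i a', a' <> 1, X j b', b' <> 1 & (a, b) <> (a', b')]).
  have killer g u : u <> 1 -> exists v, [/\ orbit_preserving v,
      act (act (base 1) g) v = act (base 1) g & u * v <> v * u].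
    (* Conjugation by [k] moves the point to [y0], which [X j] fixes. *)
    move=> u1; set k := (s * x)^-1 * g.
    have u1' : k * u * k^-1 <> 1.
      move=> e; apply: u1; apply: (@mulgI _ k); apply: (@mulIg _ k^-1).
      by rewrite e mulg1 mulgV.
    have [b2 [z [Xb2 Zz2 ncomm]]] := commutator_not_central fpX nij
      (fun a b Xa _ Xb _ => zz a b Xa Xb)
      Xa a1 Xb b1 Xa' a1' Xb' b1' ab u1'.
    have [sgZ normZ] := orbit_preserving_normal.
    set c := b2 * z * _ * _ in ncomm.
    have Zc : orbit_preserving c := subgroupM sgZ (normZ b2 z Zz2) (subgroupV sgZ Zz2).
    exists (k^-1 * c * k^-1^-1); split; first exact: normZ.
      rewrite invgK orbit -/k -actM mulgA mulVKg actM; congr act.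
      by have [h Hh /(commutator_fixes Hh (y0b _ Xb2))] := Zz2 y0.
    move=> e; apply: ncomm; apply: (@mulgI _ k^-1); apply: (@mulIg _ k).
    by clearbody c k; move: e; rewrite /= invgK !mulgA mulVg mul1g !mulgVK => ->.
  have z1 := zigzag_neq1 (n := n) fpX nij Xa a1 Xb b1.
  have [u' [u1 Zu fixu fixF]] := kill_points F killer z1 Zz.
  by exists u'; split=> // y yz; apply/fixu/actX.
(* Both factors have order two: conjugates of [b] invert [z]. *)
set z := zigzag a b ^+ n.+1 in Zz.
have ua t : X i t -> t <> 1 -> t = a.
  move=> Xt t1; apply: contrapT => ta; apply: same_pair.
  by exists t, b; split=> // -[] /esym.
have ub t : X j t -> t <> 1 -> t = b.
  move=> Xt t1; apply: contrapT => tb; apply: same_pair.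
  by exists a, t; split=> // -[] /esym.
exists (z^-1 * z^-1); split.
- rewrite -invgM => /eqP; rewrite invg_eq1 -expgnDr addnS => /eqP.
  exact: (zigzag_neq1 (n := n.+1 + n) fpX nij Xa a1 Xb b1).
- move=> y yz; rewrite actM; have yzV : act y z^-1 = y by apply/actK/actX.
  by rewrite !yzV.
- move=> g _; set k := (s * x)^-1 * g.
  have <- : k^-1 * b * k * z * (k^-1 * b * k)^-1 * z^-1 = z^-1 * z^-1.
    by rewrite (reflection_inverts_zigzag fpX nij ua ub).
  have [h Hh yz] := Zz (act (base 1) g).
  apply: commutator_fixes Hh _ yz.
  have -> : act (base 1) g = act y0 k by exact: orbit.
  by clearbody k; rewrite -actM !mulgA mulgV mul1g actM y0b.
Qed.

End Core.

(** * Finite Kurosh rank *)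

Lemma subgroup_word (G : groupType) (I : eqType) (P : set G) (w : seq (I * G)) :
  subgroup P -> (forall l, l \in w -> P l.2) -> P (word_value w).
Proof.
move=> sgP; elim: w => [_|l w IHw Pw].
  by rewrite word_value_nil; exact: subgroup1.
rewrite word_value_cons; apply: subgroupM => //; first by apply: Pw; rewrite mem_head.
by apply: IHw => m mw; apply: Pw; rewrite inE mw orbT.
Qed.

Lemma free_product_ind (G : groupType) (I : eqType) (X : I -> set G) (K P : set G) :
    is_free_product K X -> subgroup P ->
  (forall i x, X i x -> K x -> x <> 1 -> P x) -> K `<=` P.
Proof.
move=> [_ sgX nf] sgP XP h /nf[w [[[lw _] <-] _]].
apply: subgroup_word => // l /lw[Xl l1]; apply: (XP l.1) => //.
by case: (sgX l.1) => _; exact.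
Qed.

(** [L] consists of a basis of the free part and of the double coset
    representatives whose factors are non-trivial. *)
Lemma kurosh_rank_generated (G : groupType) (A B H : set G) :
    finite_kurosh_rank A B H ->
  exists L, generated_by (fun b : bool => if b then A else B) H L.
Proof.
move=> [_ [D [f [p [q [fT fI fJ _]]]]]].
have /finite_seqP[sT eT] : finite_set [set: kd_T D] by exists f.
have /finite_seqP[sI eI] :
  finite_set [set i | kd_HA (k:=D) i <> trivial_subgroup] by exists p.
have /finite_seqP[sJ eJ] :
  finite_set [set i | kd_KB (k:=D) i <> trivial_subgroup] by exists q.
exists (map (@kd_basis _ _ _ _ D) sT ++ map (@kd_s _ _ _ _ D) sI ++
  map (@kd_t _ _ _ _ D) sJ).
move=> P sgP PL PX; have [_ FH _] := kd_free_product D.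
have conj1 g : conj_set g [set 1] = [set (1 : G)].
  by rewrite /conj_set image_set1 mulg1 mulgV.
apply: (free_product_ind (kd_free_product D) sgP) => -[[i|j]|[]] x /=.
- move=> Xx Hx x1; have iI : i \in sI.
    have : [set` sI] i by rewrite -eI => HA1; move: Xx; rewrite HA1 conj1.
    by [].
  case: Xx Hx => y; rewrite kd_HAE => -[Ay _] <- Hy.
  by apply: (PX _ true) => //; rewrite !mem_cat map_f ?orbT.
- move=> Xx Hx x1; have jJ : j \in sJ.
    have : [set` sJ] j by rewrite -eJ => KB1; move: Xx; rewrite KB1 conj1.
    by [].
  case: Xx Hx => y; rewrite kd_KBE => -[By _] <- Hy.
  by apply: (PX _ false) => //; rewrite !mem_cat map_f ?orbT.
move=> Fx _ _; have [_ fpF] := kd_F_free D; move: x Fx.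
apply: (free_product_ind fpF sgP) => t x tx _ _.
have Hb : H (kd_basis t).
  have [_ F_H] := FH (inr tt); apply: F_H => /=.
  case: fpF => _ /(_ t)[_ cF] _; apply: cF; exists 1%N; left.
  by rewrite expg1.
have Pb : P (kd_basis t).
  apply: PL => //; rewrite mem_cat map_f //.
  by have : [set` sT] t by rewrite -eT.
by case: tx => n [] ->; [|apply: subgroupV => //]; exact: subgroupX.
Qed.

Lemma prefix_closure (G : groupType) (X : bool -> set G) (L : seq G) :
    is_free_product [set: G] X ->
  exists S0 : seq G, {subset L <= S0} /\ prefix_closed X S0.
Proof.
move=> fpX.
have spelled g : exists w : seq (bool * G),
    (forall l, l \in w -> X l.1 l.2) /\ word_value w = g.
  by have [w lw vw] := word_exists fpX g; exists w.
have [w wP] := choice spelled.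
pose S0 := [seq word_value (take n (w g)) | g <- L, n <- iota 0 (size (w g)).+1].
have prefix g n : g \in L -> word_value (take n (w g)) \in S0.
  move=> Lg; apply/allpairsPdep; exists g, (minn n (size (w g))); split=> //.
    by rewrite mem_iota /= add0n ltnS geq_minr.
  by congr word_value; rewrite /minn; case: ltnP => // ?; rewrite take_size take_oversize.
exists S0; split=> [g Lg|s /allpairsPdep[g [n [Lg _ ->]]]].
  by have := prefix g (size (w g)) Lg; rewrite take_size (proj2 (wP g)).
exists (take n (w g)); split=> // [l /mem_take /(proj1 (wP g)) //|w1 w2 e].
have := prefix g (minn (size w1) n) Lg.
by rewrite take_min e take_size_cat.
Qed.

(** A core that cannot be left is the whole group, which is then covered by the
    finitely many cosets [H s]; inversion turns these into left cosets. *)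
Lemma core_full_finite_index (G : groupType) (X : bool -> set G) (H : set G)
    (S0 : seq G) :
    is_free_product [set: G] X -> subgroup H -> 1 \in S0 ->
    (forall s i x, core H S0 s -> X i x -> core H S0 (s * x)) ->
  finite_index H.
Proof.
move=> fpX sgH S01 closed.
have full g : core H S0 g.
  have [w lw <-] := word_exists fpX g; elim/last_ind: w lw => [_|w l IHw lw].
    by rewrite word_value_nil; exact: core_S0.
  rewrite -cats1 word_value_cat word_value_cons word_value_nil mulg1.
  apply: (closed _ l.1); last by apply: lw; rewrite mem_rcons mem_head.
  by apply: IHw => m mw; apply: lw; rewrite mem_rcons inE mw orbT.
apply: (@sub_finite_set _ _ [set left_coset H s^-1 | s in [set` S0]]); last first.
  exact/finite_image/finite_seq.
move=> _ [g _ <-]; have [h Hh [s Ss e]] := full g^-1.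
exists s => //; have -> : g = s^-1 * h^-1 by rewrite -invgM -e invgK.
apply/seteqP; split=> _ [k Hk <-].
  exists (h * k); first exact: subgroupM.
  by rewrite !mulgA mulgVK.
exists (h^-1 * k); first by apply: subgroupM => //; exact: subgroupV.
by rewrite mulgA.
Qed.

Theorem theorem1 (G : groupType) (A B H : set G)
    (hG : is_free_product2 [set: G] A B)
    (hA : A <> trivial_subgroup) (hB : B <> trivial_subgroup)
    (hH : subgroup H) (hr : finite_kurosh_rank A B H) :
  finite_index H <->
  (forall N : set G, normal_subgroup N -> N <> trivial_subgroup ->
     H `&` N <> trivial_subgroup).
Proof.
pose X (b : bool) := if b then A else B.
have ntX i : X i <> trivial_subgroup by case: i.
split=> [finH N normN ntN HN|meets].
  have [g [i [w [j [Ng sg nij]]]]] := normal_subgroup_spells hG ntX normN ntN.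
  have [n n0 Hgn] := finite_index_power hH g finH.
  have [v sgn] := spells_exp n.-1 sg nij; apply: (spells_neq1 hG sgn).
  have : (H `&` N) (g ^+ n) by split=> //; apply: subgroupX; case: normN.
  by rewrite prednK // HN.
have [L genL] := kurosh_rank_generated hr.
have [S0 [L_S0 S0_conn]] := prefix_closure (1 :: L) hG.
have S01 : 1 \in S0 by apply: L_S0; rewrite mem_head.
have genS0 : generated_by X H S0.
  have sub s : s \in L -> s \in S0 by move=> Ls; apply: L_S0; rewrite inE Ls orbT.
  move=> P sgP PS PX; apply: genL => // [s /sub|s i x /sub]; [exact: PS|exact: PX].
have [act actP act_run] := free_product_action (@slide1 G H S0)
  (@slideM G H S0) hG.
apply: contrapT => infH.
have [[s [i [x [cs Xx nsx]]]]|closed] := pselect (exists s i x,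
    [/\ core H S0 s, X i x & ~ core H S0 (s * x)]); last first.
  apply: infH; apply: (core_full_finite_index hG hH S01) => s i x cs Xx.
  by apply: contrapT => nsx; apply: closed; exists s, i, x.
have [u u1 u_trivial] := acts_trivially_exists hG hH actP act_run S0_conn genS0
  ntX cs Xx nsx.
pose N := [set g | forall y, act y g = y].
have [a1 aM] := actP.
apply: (meets N).
- split; [split=> [|g h Ng Nh] y|move=> g z Nz y].
  + exact: a1.
  + by rewrite aM Ng; apply: actK.
  + by rewrite 2!aM Nz; apply: actK.
- by move=> N1; apply: u1; have : N u by []; rewrite N1.
apply/seteqP; split=> [g [Hg Ng] | _ ->]; last first.
  by split=> //; exact: subgroup1.
exact: (kernel_H hG hH actP act_run S0_conn genS0 Hg Ng).
Qed.
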